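(* Let $G$ be an $n$-vertex connected bipartite graph with independence number $i$, where $\lceil n/2\rceil\leqslant i\leqslant n-1$. If $\alpha\in[\frac12,1)$, then $\lambda_\alpha(G)\leqslant\lambda_\alpha(K_{i,n-i})$, with equality if and only if $G\cong K_{i,n-i}$. In particular, if $G$ is an $n$-vertex tree with independence number $i$ (with $\lceil n/2\rceil\leqslant i\leqslant n-1$) and $n\geqslant 4$, and $\alpha\in[0,1)$, then $\lambda_\alpha(G)\leqslant\lambda_\alpha(S^*_{n,i})$, with equality if and only if $G\cong S^*_{n,i}$.
   Context: For a graph $G$ with adjacency matrix $A(G)$ and diagonal degree matrix $D(G)$, and $\alpha\in[0,1]$, $A_\alpha(G)=\alpha D(G)+(1-\alpha)A(G)$ and $\lambda_\alpha(G)$ denotes its largest eigenvalue. The independence number is the maximum size of a set of pairwise non-adjacent vertices. For $k\geqslant 1$, $S^*_{n,n-k}$ is the $n$-vertex tree obtained from the star $K_{1,n-k}$ by attaching one pendant edge to each of $k-1$ of its non-central vertices; thus $S^*_{n,i}$ is obtained from $K_{1,i}$ by attaching a pendant edge to each of $n-i-1$ leaves. *)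

(* Defs.v *)
From HB Require Import structures.
From mathcomp Require Import all_boot all_order all_algebra.
From mathcomp Require Import classical_sets reals.

Set Implicit Arguments.
Unset Strict Implicit.
Unset Printing Implicit Defensive.

Import Order.TTheory GRing.Theory Num.Theory.

Local Open Scope ring_scope.

Record sgraph (n : nat) := SGraph {
  adj :> rel 'I_n;
  adj_sym : symmetric adj;
  adj_irrefl : irreflexive adj }.

Definition isomorphic (n m : nat) (G : sgraph n) (H : sgraph m) : Prop :=
  exists2 f : 'I_n -> 'I_m, bijective f & forall u v, H (f u) (f v) = G u v.

Definition is_connected (n : nat) (G : sgraph n) : Prop :=
  forall u v : 'I_n, connect G u v.

Definition is_bipartite (n : nat) (G : sgraph n) : Prop :=
  exists c : 'I_n -> bool, forall u v, G u v -> c u != c v.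

(* [cycle] accepts sequences of length 2 that go back and forth along an edge;
   graph cycles are those of length at least 3. *)
Definition acyclic (n : nat) (G : sgraph n) : Prop :=
  forall c : seq 'I_n, (2 < size c)%N -> ~ ucycle G c.

Definition is_tree (n : nat) (G : sgraph n) : Prop :=
  is_connected G /\ acyclic G.

Definition independent (n : nat) (G : sgraph n) (S : {set 'I_n}) : bool :=
  [forall u in S, forall v in S, ~~ G u v].

Definition independence_number (n : nat) (G : sgraph n) : nat :=
  \max_(S : {set 'I_n} | independent G S) #|S|.

Definition degree (n : nat) (G : sgraph n) (v : 'I_n) : nat :=
  #|[pred u | G v u]|.

Definition adjacency_mx (R : realType) (n : nat) (G : sgraph n) : 'M[R]_n :=
  \matrix_(u, v) (G u v)%:R.

Definition degree_mx (R : realType) (n : nat) (G : sgraph n) : 'M[R]_n :=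
  diag_mx (\row_v (degree G v)%:R).

Definition A_alpha (R : realType) (alpha : R) (n : nat) (G : sgraph n) :
    'M[R]_n :=
  alpha *: degree_mx R G + (1 - alpha) *: adjacency_mx R G.

(* A real symmetric matrix of positive size has a nonempty finite set of real
   eigenvalues, so this supremum is a maximum. *)
Definition lambda (R : realType) (alpha : R) (n : nat) (G : sgraph n) : R :=
  sup [set x : R | eigenvalue (A_alpha alpha G) x]%classic.

Section CompleteBipartite.
Variables p q : nat.

Definition Kbip_adj : rel 'I_(p + q) :=
  fun u v => (u < p)%N (+) (v < p)%N.

Fact Kbip_sym : symmetric Kbip_adj.
Proof. by move=> u v; rewrite /Kbip_adj addbC. Qed.

Fact Kbip_irrefl : irreflexive Kbip_adj.
Proof. by move=> u; rewrite /Kbip_adj addbb. Qed.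

Definition Kbip : sgraph (p + q) := SGraph Kbip_sym Kbip_irrefl.
End CompleteBipartite.

(* S*_{n,i}: vertex 0 is the center of K_{1,i}, vertices 1, ..., i are its
   leaves, and each vertex i + j with 1 <= j <= n - i - 1 is pendant at the
   leaf j.  This is meaningful when n - i - 1 <= i < n. *)
Section SStar.
Variables n i : nat.

Definition Sstar_arc : rel 'I_n := fun u v =>
  ((u == 0 :> nat) && (0 < v <= i)%N) || ((0 < u <= i)%N && (v == i + u :> nat)%N).

Definition Sstar_adj : rel 'I_n := fun u v => Sstar_arc u v || Sstar_arc v u.

Fact Sstar_sym : symmetric Sstar_adj.
Proof. by move=> u v; rewrite /Sstar_adj orbC. Qed.

Fact Sstar_irrefl : irreflexive Sstar_adj.
Proof.
move=> u; rewrite /Sstar_adj /Sstar_arc orbb.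
case: (posnP u) => [->|u_gt0] //=.
rewrite eqn_leq (leqNgt (i + u)) -[X in (X < i + u)%N]add0n ltn_add2r.
by case: i => [|j]; rewrite ?andbF // leqn0 -lt0n in u_gt0 *; case: (val u) u_gt0.
Qed.

Definition Sstar : sgraph n := SGraph Sstar_sym Sstar_irrefl.
End SStar.

(* Main.v *)
(** If [x] is positive and [A_alpha G x <= mu x] entrywise then every eigenvalue is
    at most [mu], and for connected [G] the value [mu] is an eigenvalue only if
    equality holds at every vertex; so it suffices to exhibit test vectors.

    Bipartite graphs with classes of sizes [a >= b]: the Perron vector of K_{a,b}
    is a test vector, and [lambda (K_{a,b})] does not decrease when [a] grows to [i]
    and [a + b] is fixed.

    Trees: only #leaves <= i is used.  Root [G] at a vertex [r] of maximal degree,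
    give weight [Lw] to leaves and [Dw < Lw] to the other non-root vertices, and
    let [W v] be the weight of the subtree at [v].  With constants read off the
    Perron vector of S*_{n,i}, whose eigenvalue is [mu = i Lw + (n - i - 1) Dw], the
    vector with [x_v / x_parent = (W v - alpha) / (1 - alpha)] is a test vector: at
    [r] the condition is [W r <= mu], at a leaf it is an equality, and at any other
    [v], with [t = W v - Dw] the weight below [v], the slack is a positive multiple
    of [(t - Lw) (mu - Lw - Dw - t)], which is nonnegative since there is a leaf
    below [v] and another one outside the subtree at [v]. *)
Require Import Defs.
From HB Require Import structures.
From mathcomp Require Import all_boot all_order all_algebra.
From mathcomp Require Import classical_sets reals.
From mathcomp Require Import polyrcf ring lra zify.

Set Implicit Arguments.
Unset Strict Implicit.
Unset Printing Implicit Defensive.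

Import Order.TTheory GRing.Theory Num.Theory.

Local Open Scope ring_scope.

(** * Collatz-Wielandt bounds *)

Section Spectrum.
Variables (R : realType) (alpha : R).

Definition alpha_op n (G : sgraph n) (x : 'I_n -> R) (v : 'I_n) : R :=
  alpha * (degree G v)%:R * x v + (1 - alpha) * \sum_(u | G v u) x u.

(** [eigenvalue] refers to row vectors; the symmetry of [adj] turns it into a sum over the
    neighbours of [v], so that vectors can be plain functions from here on. *)
Lemma eigenvalue_alphaP n (G : sgraph n) (th : R) :
  eigenvalue (A_alpha alpha G) th <->
  exists2 x : 'I_n -> R,
    exists v, x v != 0 & forall v, alpha_op G x v = th * x v.
Proof.
have mulE (y : 'rV[R]_n) v :
    (y *m A_alpha alpha G) 0 v = alpha_op G (fun u => y 0 u) v.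
  rewrite mxE /alpha_op.
  under eq_bigr => u _ do rewrite !mxE mulrDr.
  rewrite big_split /= (bigD1 v) //= eqxx mulr1n big1 => [|u /negPf->]; last first.
    by rewrite mulr0n !mulr0.
  rewrite addr0 mulrC mulr_sumr [in RHS]big_mkcond /=; congr (_ + _).
  apply: eq_bigr => u _; rewrite adj_sym.
  by case: (G v u); rewrite ?mulr1 ?mulr0 // mulrC.
split=> [/eigenvalueP[y yE y0]|[x [v xv0] xE]].
  exists (fun u => y 0 u) => [|v]; last by rewrite -mulE yE mxE.
  by case/rV0Pn: y0 => v; exists v.
apply/eigenvalueP; exists (\row_u x u).
  apply/rowP => u; rewrite mulE !mxE -xE /alpha_op mxE.
  by under eq_bigr => w _ do rewrite mxE.
by apply/rV0Pn; exists v; rewrite mxE.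
Qed.

(** [n] and [m] are kept apart because [Kbip i (n - i)] has vertex type ['I_(i + (n - i))], not
    ['I_n]. *)
Lemma eigenvalue_iso n m (G : sgraph n) (H : sgraph m) (th : R) :
  isomorphic G H ->
  eigenvalue (A_alpha alpha G) th -> eigenvalue (A_alpha alpha H) th.
Proof.
case=> f [g fK gK] fH /eigenvalue_alphaP[x [v xv0] xE].
apply/eigenvalue_alphaP; exists (x \o g).
  by exists (f v); rewrite /= fK.
have sumE (T : nmodType) (F : 'I_n -> T) w :
    \sum_(u | H w u) F (g u) = \sum_(u | G (g w) u) F u.
  rewrite [RHS](reindex g) /=; last by exists f => u _.
  by apply: eq_bigl => u; rewrite -fH !gK.
move=> w; rewrite -[RHS]xE /alpha_op /= sumE; congr (_ * _%:R * _ + _).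
by rewrite /degree -!sum1_card; exact: (sumE nat (fun=> 1%N)).
Qed.

Lemma isomorphic_sym n m (G : sgraph n) (H : sgraph m) :
  isomorphic G H -> isomorphic H G.
Proof.
case=> f [g fK gK] fH; exists g; first by exists f.
by move=> u v; rewrite -fH !gK.
Qed.

Lemma lambda_iso n m (G : sgraph n) (H : sgraph m) :
  isomorphic G H -> lambda alpha G = lambda alpha H.
Proof.
move=> GH; rewrite /lambda; congr sup; apply/seteqP; split=> th /=.
  exact: eigenvalue_iso.
exact/eigenvalue_iso/isomorphic_sym.
Qed.

(** The supremum of the empty set is 0, so a nonzero [lambda] has a nonempty spectrum; this is the
    finite list of real roots of the characteristic polynomial, and the supremum is its maximum. *)
Lemma lambda_eigenvalue n (G : sgraph n) :
  lambda alpha G != 0 -> eigenvalue (A_alpha alpha G) (lambda alpha G).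
Proof.
set A := A_alpha alpha G => l0.
have char0 : char_poly A != 0 by rewrite monic_neq0 // char_poly_monic.
have rE th : eigenvalue A th = (th \in rootsR (char_poly A)).
  by rewrite -(roots_on_rootsR char0) in_itv eigenvalue_root_char.
have [s sE] : exists s : seq R, forall th, eigenvalue A th = (th \in s).
  by exists (rootsR (char_poly A)).
have [m ms mmax] : exists2 m, m \in s & forall th, th \in s -> th <= m.
  case: s sE => [|t s] sE.
    case/eqP: l0; rewrite /lambda (_ : [set _ | _]%classic = set0) ?sup0 //.
    by apply/seteqP; split=> th //=; rewrite sE.
  elim: s t {sE} => [|t' s IHs] t.
    by exists t => [|th]; rewrite inE // => /eqP->.
  have [m ms mmax] := IHs t'.
  have [tm|/ltW mt] := leP t m.
    exists m => [|th]; first by rewrite inE ms orbT.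
    by rewrite inE => /predU1P[->//|/mmax].
  exists t => [|th]; first exact: mem_head.
  by rewrite inE => /predU1P[->//|/mmax/le_trans]; apply.
suff -> : lambda alpha G = m by rewrite sE.
apply/eqP; rewrite eq_le; apply/andP; split.
  by apply: ge_sup => [|th /=]; [exists m; rewrite /= sE | rewrite sE => /mmax].
apply: ub_le_sup; last by rewrite /= sE.
by exists m => th /=; rewrite sE => /mmax.
Qed.

Section CollatzWielandt.
Variables (n : nat) (G : sgraph n) (x : 'I_n -> R) (mu : R).
Hypothesis alpha_lt1 : alpha < 1.
Hypothesis x_gt0 : forall v, 0 < x v.
Hypothesis x_super : forall v, alpha_op G x v <= mu * x v.

(* The eigenvector is compared with [x] at a vertex where the ratio [y / x] is
   maximal. *)
Lemma eigenvalue_le th : eigenvalue (A_alpha alpha G) th ->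
  th <= mu /\
  (th = mu -> is_connected G -> forall v, alpha_op G x v = mu * x v).
Proof.
move=> /eigenvalue_alphaP[y0 [v0 y00] y0E].
(* Negating the eigenvector if necessary gives it a positive entry, so the maximal ratio [t] is
   positive. *)
have [y [v yv] yE] : exists2 y : 'I_n -> R,
    exists v, 0 < y v & forall v, alpha_op G y v = th * y v.
  have [y0gt|] := ltP 0 (y0 v0); first by exists y0 => //; exists v0.
  rewrite le_eqVlt (negPf y00) /= => y0lt.
  exists (fun u => - y0 u) => [|w]; first by exists v0; rewrite oppr_gt0.
  by rewrite mulrN -y0E /alpha_op sumrN; ring.
case: (arg_maxP (fun u => y u / x u) (erefl : xpredT v)) => w _ wmax.
set t := y w / x w in wmax.
have t_gt0 : 0 < t by apply: lt_le_trans (wmax v isT); rewrite divr_gt0.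
have yle u : y u <= t * x u by rewrite -ler_pdivrMr //; exact: wmax.
have b_gt0 : 0 < 1 - alpha by rewrite subr_gt0.
(* At a vertex of ratio [t], [th y = op y <= t op x <= mu y]. If [th = mu], both are equalities, and
   the first one forces ratio [t] at every neighbour. *)
have step u : y u = t * x u ->
    th <= mu /\ (th = mu -> alpha_op G x u = mu * x u /\
      forall u', G u u' -> y u' = t * x u').
  move=> yu.
  have yu_gt0 : 0 < y u by rewrite yu mulr_gt0.
  have sumle : \sum_(u' | G u u') y u' <= t * \sum_(u' | G u u') x u'.
    by rewrite mulr_sumr; apply: ler_sum.
  have opy : alpha_op G y u <= t * alpha_op G x u.
    rewrite /alpha_op mulrDr lerD //; first by rewrite yu; rewrite le_eqVlt; apply/predU1P; left; ring.
    by rewrite mulrCA ler_pM2l.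
  have opx : t * alpha_op G x u <= mu * y u.
    by rewrite yu mulrCA ler_pM2l.
  split; first by rewrite -(ler_pM2r yu_gt0) -yE (le_trans opy).
  move=> thmu; have e1 : t * alpha_op G x u = mu * y u.
    by apply/eqP; rewrite eq_le opx -thmu -yE.
  have e2 : alpha_op G y u = t * alpha_op G x u by rewrite yE e1 thmu.
  split.
    by apply: (mulfI (lt0r_neq0 t_gt0)); rewrite e1 yu; ring.
  have e3 : \sum_(u' | G u u') (t * x u' - y u') = 0.
    apply: (mulfI (lt0r_neq0 b_gt0)); rewrite mulr0 sumrB -mulr_sumr.
    by move: e2; rewrite /alpha_op yu => e2; lra.
  move=> u' Guu'; apply/eqP; rewrite eq_sym -subr_eq0; apply/eqP.
  by apply: (psumr_eq0P _ e3) => // w' _; rewrite subr_ge0.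
have yw : y w = t * x w by rewrite /t divfK // gt_eqF.
split; first by have [] := step w yw.
move=> thmu conn u.
suff : y u = t * x u by move=> /step[_ /(_ thmu)[]].
(* Connectedness carries the ratio [t] from [w] to every vertex. *)
have /connectP[p + ->] := conn w u; clearbody t.

elim: p w {wmax} yw step => [//|u' p IHp] w yw step /= /andP[Gwu' Gp].
by apply: (IHp u' _ step Gp); have [_ /(_ thmu)[_]] := step w yw; apply.
Qed.

(** The hypothesis [0 <= mu] settles [lambda = 0], which may be the default value of the
    supremum. *)
Lemma lambda_le : 0 <= mu -> lambda alpha G <= mu.
Proof.
have [->//|l0 _] := eqVneq (lambda alpha G) 0.
by have [] := eigenvalue_le (lambda_eigenvalue l0).
Qed.

Lemma lambda_eq : 0 < mu -> is_connected G -> lambda alpha G = mu ->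
  forall v, alpha_op G x v = mu * x v.
Proof.
move=> mu0 conn lE; have /lambda_eigenvalue : lambda alpha G != 0.
  by rewrite lE gt_eqF.
by case/eigenvalue_le=> _; apply.
Qed.
End CollatzWielandt.

Lemma lambda_positive_eigenvector n (G : sgraph n) (x : 'I_n -> R) mu :
  alpha < 1 -> (0 < n)%N -> 0 <= mu -> (forall v, 0 < x v) ->
  (forall v, alpha_op G x v = mu * x v) -> lambda alpha G = mu.
Proof.
move=> a1 n_gt0 mu0 x0 xE; have xle v : alpha_op G x v <= mu * x v by rewrite xE.
apply/eqP; rewrite eq_le (lambda_le a1 x0 xle mu0); apply: ub_le_sup.
  by exists mu => th /= /(eigenvalue_le a1 x0 xle)[].
apply/eigenvalue_alphaP; exists x => //.
by exists (Ordinal n_gt0); rewrite gt_eqF.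
Qed.
End Spectrum.

(** * Bipartite graphs *)

Section Bipartite.
Variables (R : realType) (alpha : R).
Hypothesis alpha_ge : 1 / 2 <= alpha.
Hypothesis alpha_lt1 : alpha < 1.

(* The largest root of the quadratic (mu - alpha a)(mu - alpha b) = (1 - alpha)^2 a b
   obtained from the quotient of K_{a,b} by its two colour classes. *)
Definition Kbip_radius (a b : nat) : R :=
  (alpha * (a + b)%:R
   + Num.sqrt ((alpha * (a + b)%:R) ^+ 2 - 4 * (2 * alpha - 1) * (a * b)%:R)) / 2.

Section Radius.
Variables a b : nat.
Hypotheses (a_gt0 : (0 < a)%N) (b_gt0 : (0 < b)%N).
Let mu := Kbip_radius a b.

Lemma Kbip_radiusP : alpha * b%:R < mu /\
  (mu - alpha * a%:R) * (mu - alpha * b%:R) = (1 - alpha) ^+ 2 * a%:R * b%:R.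
Proof.
have A0 : 0 < a%:R :> R by rewrite ltr0n.
have B0 : 0 < b%:R :> R by rewrite ltr0n.
have c0 : 0 < (1 - alpha) ^+ 2 by rewrite exprn_gt0 // subr_gt0.
rewrite /mu /Kbip_radius natrD natrM; set A := a%:R in A0 *; set B := b%:R in B0 *.
set D := (X in Num.sqrt X).
(* In this form the discriminant exceeds [(alpha (B - A))^2], so its root exceeds [alpha (B - A)],
   which is the bound [alpha b < mu]. *)
have DE : D = (alpha * (B - A)) ^+ 2 + 4 * ((1 - alpha) ^+ 2 * (A * B)).
  by rewrite /D; ring.
have AB0 : 0 < (1 - alpha) ^+ 2 * (A * B) by apply: mulr_gt0 => //; exact: mulr_gt0.
have D0 : 0 <= D by rewrite DE addr_ge0 ?sqr_ge0 //; lra.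
have S2 := sqr_sqrtr D0; have S0 := sqrtr_ge0 D.
have lt : `|alpha * (B - A)| < Num.sqrt D.
  by rewrite -sqrtr_sqr ltr_sqrt ?DE; [lra | rewrite ltr_wpDl ?sqr_ge0 //; lra].
split; first by have := ler_norm (alpha * (B - A)); lra.
set S := Num.sqrt D in S2 *.
transitivity ((S ^+ 2 - (alpha * (B - A)) ^+ 2) / 4); first by field.
by rewrite S2 DE; field.
Qed.

Lemma Kbip_radius_gt0 : 0 < mu.
Proof.
have [+ _] := Kbip_radiusP; apply: le_lt_trans.
by rewrite mulr_ge0 ?ler0n //; have := alpha_ge; lra.
Qed.

Variables (n : nat) (G : sgraph n) (c : 'I_n -> bool).
Hypothesis c_proper : forall u v, G u v -> c u != c v.
Hypothesis cardT : #|[pred v | c v]| = a.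
Hypothesis cardF : #|[pred v | ~~ c v]| = b.

(** The Perron vector of K_{a,b}: the entries solve [(mu - alpha b) x_T = (1 - alpha) b x_F], the
    eigenvalue equation at a vertex coloured [true]. *)
Definition bip_vec (v : 'I_n) : R :=
  if c v then (1 - alpha) * b%:R else mu - alpha * b%:R.

Lemma bip_vec_gt0 v : 0 < bip_vec v.
Proof.
rewrite /bip_vec; case: (c v).
  by rewrite mulr_gt0 ?ltr0n // subr_gt0.
by rewrite subr_gt0; case: Kbip_radiusP.
Qed.

Lemma bip_degree_le v : (degree G v <= if c v then b else a)%N.
Proof.
case cv : (c v); rewrite /= /degree.
  rewrite -cardF; apply: subset_leq_card.
  by apply/fintype.subsetP=> u; rewrite !inE => /c_proper; rewrite cv; case: (c u).
rewrite -cardT; apply: subset_leq_card.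
by apply/fintype.subsetP=> u; rewrite !inE => /c_proper; rewrite cv; case: (c u).
Qed.

(** All neighbours of [v] carry the same entry, so the operator is proportional to the degree; for
    the full degree it is multiplication by [mu]. *)
Lemma bip_opE v : alpha_op alpha G bip_vec v =
  mu * bip_vec v * ((degree G v)%:R / (if c v then b else a)%:R).
Proof.
have A0 : a%:R != 0 :> R by rewrite pnatr_eq0 -lt0n.
have B0 : b%:R != 0 :> R by rewrite pnatr_eq0 -lt0n.
have [_ muE] := Kbip_radiusP.
have -> : alpha_op alpha G bip_vec v = (degree G v)%:R * (alpha * bip_vec v
    + (1 - alpha) * (if c v then mu - alpha * b%:R else (1 - alpha) * b%:R)).
  rewrite /alpha_op (eq_bigr (fun=> if c v then mu - alpha * b%:R
    else (1 - alpha) * b%:R)) => [|u /c_proper].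
    by rewrite sumr_const -[X in _ *+ X]/(degree G v) -mulr_natr; ring.
  by rewrite /bip_vec; case: (c v); case: (c u).
rewrite /bip_vec; case: (c v); first by field.
apply: (mulIf A0); rewrite !mulrA divfK //.
set d := (degree G v)%:R.
transitivity (d * (alpha * a%:R * (mu - alpha * b%:R)
  + (1 - alpha) ^+ 2 * a%:R * b%:R)); first by ring.
by rewrite -muE; ring.
Qed.

Lemma bip_op_le v : alpha_op alpha G bip_vec v <= mu * bip_vec v.
Proof.
have mx0 : 0 < mu * bip_vec v by rewrite mulr_gt0 ?bip_vec_gt0 ?Kbip_radius_gt0.
rewrite bip_opE ger_pMr // ler_pdivrMr ?mul1r ?ler_nat ?bip_degree_le //.
by rewrite ltr0n; case: ifP.
Qed.

Lemma bip_op_eq :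
  (forall v, alpha_op alpha G bip_vec v = mu * bip_vec v) <->
  (forall u v, G u v = (c u != c v)).
Proof.
have C0 v : (if c v then b else a)%:R != 0 :> R.
  by rewrite pnatr_eq0 -lt0n; case: ifP.
split=> [opE u v|GE v]; last first.
  rewrite bip_opE; suff -> : degree G v = (if c v then b else a).
    by rewrite divff // mulr1.
  rewrite -cardT -cardF /degree; case cv : (c v); apply: eq_card => u.
    by rewrite !inE GE cv; case: (c u).
  by rewrite !inE GE cv; case: (c u).
apply/idP/idP => [/c_proper //|cuv].
have dE : degree G u = if c u then b else a.
  apply/eqP; rewrite -(eqr_nat R); apply/eqP.
  have mx0 : mu * bip_vec u != 0.
    by rewrite gt_eqF // mulr_gt0 ?bip_vec_gt0 ?Kbip_radius_gt0.
  have := opE u; rewrite bip_opE -[RHS]mulr1 => /(mulfI mx0) e.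
  by rewrite -[LHS](divfK (C0 u)) e mul1r.
have : [pred w | G u w] =i [pred w | c u != c w].
  apply/subset_cardP; last by apply/fintype.subsetP=> w; rewrite !inE => /c_proper.
  rewrite -[LHS]/(degree G u) dE -cardT -cardF; case cu : (c u).
    by apply: eq_card => w; rewrite !inE; case: (c w).
  by apply: eq_card => w; rewrite !inE; case: (c w).
by move/(_ v); rewrite !inE cuv.
Qed.

Lemma bip_lambda_le : lambda alpha G <= mu.
Proof.
by apply: (lambda_le alpha_lt1 bip_vec_gt0 bip_op_le); exact/ltW/Kbip_radius_gt0.
Qed.

Lemma bip_lambda_eq : is_connected G -> lambda alpha G = mu ->
  forall u v, G u v = (c u != c v).
Proof.
move=> Gc lE; apply/bip_op_eq.
exact: (lambda_eq alpha_lt1 bip_vec_gt0 bip_op_le Kbip_radius_gt0).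
Qed.

Lemma complete_bip_lambda : (forall u v, G u v = (c u != c v)) ->
  lambda alpha G = mu.
Proof.
move/bip_op_eq; apply: lambda_positive_eigenvector bip_vec_gt0 => //.
  by rewrite -[n]card_ord; apply: leq_trans (max_card [pred v | c v]); rewrite cardT.
exact/ltW/Kbip_radius_gt0.
Qed.

End Radius.

(** For a fixed sum only the term [- 4 (2 alpha - 1) a b] under the root varies, and [1/2 <= alpha]
    makes it non-increasing in the product. *)
Lemma Kbip_radius_mono a b a' b' : (a + b = a' + b')%N -> (a' * b' <= a * b)%N ->
  Kbip_radius a b <= Kbip_radius a' b'.
Proof.
move=> sE; rewrite -(ler_nat R) => ple; rewrite /Kbip_radius sE ler_pM2r ?invr_gt0 //.
rewrite lerD2l ler_wsqrtr // lerD2l lerN2 ler_wpM2l //.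
by have := alpha_ge; lra.
Qed.

Lemma card_ord_lt p m : (p <= m)%N -> #|[pred v : 'I_m | (v < p)%N]| = p.
Proof.
move=> pm; have wi : injective (widen_ord pm) by move=> u v [/val_inj].
rewrite -[RHS]card_ord -(card_codom wi).
apply: eq_card => v; rewrite !inE; apply/idP/codomP => [vp|[w ->]].
  by exists (Ordinal vp); exact: val_inj.
exact: (ltn_ord w).
Qed.

Lemma Kbip_lambda p q : (0 < p)%N -> (0 < q)%N ->
  lambda alpha (Kbip p q) = Kbip_radius p q.
Proof.
move=> p0 q0; have cp := card_ord_lt (leq_addr q p).
apply: (@complete_bip_lambda p q p0 q0 _ _ (fun v => (v < p)%N)) => [u v|||].
- by rewrite /= /Kbip_adj; case: (u < p)%N; case: (v < p)%N.
- by [].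
- have := cardC [pred v : 'I_(p + q) | (v < p)%N].
  by rewrite cp card_ord => /addnI.
- by move=> u v; rewrite /= /Kbip_adj; case: (u < p)%N; case: (v < p)%N.
Qed.
End Bipartite.

(** * Recognising K_{a,b}, and the bound for bipartite graphs *)

Lemma complete_bip_iso n (G : sgraph n) (c : 'I_n -> bool) p q :
  #|[pred v | c v]| = p -> #|[pred v | ~~ c v]| = q ->
  (forall u v, G u v = (c u != c v)) -> isomorphic G (Kbip p q).
Proof.
move=> cp cq GE.
pose e1 := enum [pred v | c v]; pose e2 := enum [pred v | ~~ c v].
pose fn v := (if c v then index v e1 else p + index v e2)%N.
have i1 v : c v -> (index v e1 < p)%N.
  by move=> cv; rewrite -cp cardE index_mem mem_enum.
have i2 v : ~~ c v -> (index v e2 < q)%N.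
  by move=> cv; rewrite -cq cardE index_mem mem_enum.
have fP v : (fn v < p + q)%N.
  rewrite /fn; case: ifPn => [/i1/ltn_addr//|/i2]; by rewrite ltn_add2l.
have fnp v : (fn v < p)%N = c v.
  by rewrite /fn; case: ifPn => [/i1//|_]; rewrite ltnNge leq_addr.
exists (fun v => Ordinal (fP v)) => [|u v]; last first.
  by rewrite GE /= /Kbip_adj /= !fnp; case: (c u); case: (c v).
apply: inj_card_bij => [u v [fuv]|]; last first.
  by rewrite !card_ord -{1}[n]card_ord -(cardC [pred v | c v]) cp -cq.
have cuv : c u = c v by rewrite -!fnp fuv.
move: fuv; rewrite /fn -cuv; case: ifPn => cu.
  by move/(index_inj u); apply; rewrite mem_enum inE -?cuv.
by move/addnI/(index_inj u); apply; rewrite mem_enum inE -?cuv.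
Qed.

Lemma independence_number_ge n (G : sgraph n) (P : pred 'I_n) :
  (forall u v, P u -> P v -> ~~ G u v) -> (#|P| <= independence_number G)%N.
Proof.
move=> Pi; rewrite -(cardsE P) /independence_number.
apply: (@leq_bigmax_cond _ (independent G) (fun S => #|S|)).
by apply/forall_inP => u; rewrite inE => Pu; apply/forall_inP => v; rewrite inE; apply: Pi.
Qed.

(** An independent set cannot meet both classes. *)
Lemma complete_bip_independence n (G : sgraph n) (c : 'I_n -> bool) :
  (#|[pred v | ~~ c v]| <= #|[pred v | c v]|)%N ->
  (forall u v, G u v = (c u != c v)) ->
  (independence_number G <= #|[pred v | c v]|)%N.
Proof.
move=> cle GE; apply/bigmax_leqP => S /forall_inP Sind.
have same u v : u \in S -> v \in S -> c u = c v.
  by move=> uS /(forall_inP (Sind u uS)); rewrite GE negbK => /eqP.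
case: (set_0Vmem S) => [->|[w wS]]; first by rewrite cards0.
case cw : (c w); last apply: leq_trans cle.
  by apply/subset_leq_card/fintype.subsetP=> u uS; rewrite inE (same u w) ?cw.
by apply/subset_leq_card/fintype.subsetP=> u uS; rewrite inE (same u w) ?cw.
Qed.

Lemma connected_neighbor n (G : sgraph n) (v : 'I_n) :
  is_connected G -> (1 < n)%N -> exists u, G v u.
Proof.
move=> Gc n1; have [w wv] : exists w, w != v.
  have : (0 < #|predC1 v|)%N by rewrite cardC1 card_ord -subn1 subn_gt0.
  by case/card_gt0P=> w wv; exists w.
have /connectP[[|u p] /= ] := Gc v w; first by move=> _ wE; rewrite wE eqxx in wv.
by case/andP=> Gvu _ _; exists u.
Qed.

Lemma bipartite_bound (R : realType) n i (G : sgraph n) (alpha : R) :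
  is_connected G -> is_bipartite G ->
  independence_number G = i -> (uphalf n <= i < n)%N ->
  1 / 2 <= alpha < 1 ->
  lambda alpha G <= lambda alpha (Kbip i (n - i))
  /\ (lambda alpha G = lambda alpha (Kbip i (n - i))
      <-> isomorphic G (Kbip i (n - i))).
Proof.
move=> Gc [c0 c0P] iE /andP[ni iltn] /andP[a2 a1].
have n1 : (1 < n)%N by lia.
(* Swapping the colours if necessary makes the class [true] the larger one. *)
have [c cP cle] : exists2 c : 'I_n -> bool, forall u v, G u v -> c u != c v
    & (#|[pred v | ~~ c v]| <= #|[pred v | c v]|)%N.
  case: (leqP #|[pred v | ~~ c0 v]| #|[pred v | c0 v]|) => [|/ltnW] le.
    by exists c0.
  exists (fun v => ~~ c0 v) => [u v /c0P|]; first by case: (c0 u); case: (c0 v).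
  by apply: leq_trans le; apply/eq_leq/eq_card=> v; rewrite !inE negbK.
set b := #|[pred v | ~~ c v]| in cle; set a := #|[pred v | c v]| in cle.
have abn : (a + b = n)%N by rewrite -[RHS]card_ord -(cardC [pred v | c v]).
have b_gt0 : (0 < b)%N.
  pose v0 := Ordinal (ltnW n1); have [u /cP] := connected_neighbor v0 Gc n1.
  case cv : (c v0) => cu; apply/card_gt0P.
    by exists u; rewrite inE; case: (c u) cu.
  by exists v0; rewrite inE cv.
have a_gt0 : (0 < a)%N by exact: leq_trans cle.
have ai : (a <= i)%N.
  rewrite -iE; apply: independence_number_ge => u v cu cv.
  by apply/negP => /cP; rewrite [c u]cu [c v]cv.
have i_gt0 : (0 < i)%N by exact: leq_trans ai.
have ni_gt0 : (0 < n - i)%N by rewrite subn_gt0.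
rewrite Kbip_lambda //.
have le1 := bip_lambda_le a2 a1 a_gt0 b_gt0 cP (erefl a) (erefl b).
(* As [b <= a <= i] and [a + b = n], the product can only drop from [a b] to [i (n - i)]. *)
have le2 : Kbip_radius alpha a b <= Kbip_radius alpha i (n - i).
  by apply: Kbip_radius_mono => //; [lia | nia].
split; first exact: le_trans le2.
split=> [lE|GK]; last by rewrite (lambda_iso alpha GK) Kbip_lambda.
have lab : lambda alpha G = Kbip_radius alpha a b.
  by apply/eqP; rewrite eq_le le1 lE.
have GE := bip_lambda_eq a2 a1 a_gt0 b_gt0 cP (erefl a) (erefl b) Gc lab.
have /eqP ia : i == a by rewrite eqn_leq ai -iE complete_bip_independence.
by apply: complete_bip_iso GE; rewrite -/a -/b; lia.
Qed.

(** * Rooted trees *)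

(** [p] is the parent map and [d] the depth; the clauses constrain [p] only away from [r]. *)
Definition rooting n (G : sgraph n) (r : 'I_n) (p : 'I_n -> 'I_n)
    (d : 'I_n -> nat) : Prop :=
  [/\ d r = 0%N, forall v, v != r -> d v = (d (p v)).+1
    & forall u v, G u v = (u != r) && (p u == v) || (v != r) && (p v == u)].

Section Rooting.
Variables (n : nat) (G : sgraph n) (r : 'I_n) (p : 'I_n -> 'I_n) (d : 'I_n -> nat).
Hypothesis Gr : rooting G r p d.

Definition child (v : 'I_n) : pred 'I_n := [pred c | (c != r) && (p c == v)].
Definition leaf (v : 'I_n) : bool := (v != r) && [forall c, ~~ child v c].

Lemma child_depth v c : child v c -> d c = (d v).+1.
Proof. by case: Gr => _ dS _ /andP[/dS-> /eqP->]. Qed.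

Lemma leafPn v : v != r -> reflect (exists c, child v c) (~~ leaf v).
Proof.
move=> vr; rewrite /leaf vr /= negb_forall.
by apply: (iffP existsP) => -[c]; [move/negPn | move=> cv]; exists c => //; apply/negPn.
Qed.

Lemma leaf_child v c : leaf v -> child v c = false.
Proof. by case/andP=> _ /forallP/(_ c)/negPf. Qed.

(** The neighbours of [v] are its parent and its children, and depth keeps the two apart. *)
Lemma rooting_sum (T : nmodType) (F : 'I_n -> T) v :
  \sum_(u | G v u) F u =
  (if v == r then 0 else F (p v)) + \sum_(c | child v c) F c.
Proof.
have [_ dS GE0] := Gr.
have GE u : G v u = (v != r) && (p v == u) || child v u by exact: GE0.
rewrite (bigID (child v)) /= addrC; congr (_ + _); last first.
  by apply: eq_bigl => u; rewrite GE; case: (child v u); rewrite ?orbT ?andbF.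
case: (eqVneq v r) => [vr|vr] /=.
  by apply: big_pred0 => u; rewrite GE vr eqxx /= andbN.
apply: big_pred1 => u; rewrite GE vr /= eq_sym.
case: (eqVneq u (p v)) => [->|_] /=; last exact: andbN.
by apply/negP => /child_depth; rewrite (dS v) //; lia.
Qed.

Lemma rooting_degree v : degree G v = ((v != r) + #|child v|)%N.
Proof.
rewrite /degree -!sum1_card (rooting_sum (fun=> 1%N)).
by case: (v == r).
Qed.

(** Every vertex except the root is a child of exactly one vertex. *)
Lemma sum_children : (\sum_v #|child v|)%N = n.-1.
Proof.
rewrite -[in RHS](card_ord n) -(cardC1 r) -sum1_card.
under eq_bigr => v _ do rewrite -sum1_card.
rewrite (exchange_big_dep (predC1 r)) /= => [|v c _ /andP[]//].
by apply: eq_bigr => c cr; rewrite (big_pred1 (p c)) // => v; rewrite inE cr eq_sym.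
Qed.

Lemma subtree_sums (T : nmodType) (f : 'I_n -> T) :
  exists W : 'I_n -> T,
    (forall v, W v = f v + \sum_(c | child v c) W c) /\ W r = \sum_v f v.
Proof.
have [dr dS _] := Gr.
(* [a w v] counts the occurrences of [v] on the path from [w] to the root, so it indicates whether
   [w] lies in the subtree at [v]. *)
pose a w v := (\sum_(j < (d w).+1) (iter j p w == v))%N.
have ar v : a r v = (r == v) by rewrite /a dr big_ord1.
have aS w v : w != r -> a w v = ((w == v) + a (p w) v)%N.
  move=> wr; rewrite /a big_ord_recl /=; congr addn.
  by rewrite (dS w wr); apply: eq_bigr => j _; rewrite -iterSr.
(* [aS] removes the lower end [w] of the path; here the path is instead cut just below [v], at the
   child of [v] it goes through. *)
have aE w v : a w v = ((w == v) + \sum_(c | child v c) a w c)%N.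
  have [m] := ubnP (d w); elim: m w => // m IHm w.
  have [->|wr] := eqVneq w r.
    rewrite ar big1 ?addn0 // => c /andP[cr _].
    by rewrite ar eq_sym (negPf cr).
  rewrite (dS w wr) ltnS => /IHm IH; rewrite aS // IH.
  rewrite [in RHS](eq_bigr _ (fun c _ => aS w c wr)).
  rewrite big_split /=; congr (_ + (_ + _))%N.
  rewrite -big_mkcondr /= sum1_card.
  rewrite -[LHS]/(nat_of_bool _); case: (eqVneq (p w) v) => pw.
    rewrite (eq_card1 (x := w)) // => c; rewrite [LHS]unfold_in eq_sym.
    case: (eqVneq c w) => [->|cw]; first by rewrite /child /= wr pw !eqxx inE eqxx.
    by rewrite andbF inE (negPf cw).
  rewrite eq_card0 // => c; rewrite [LHS]unfold_in.
  by case: eqVneq => [<-|]; rewrite ?andbF // /child /= (negPf pw) andbF.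
have a1 w : a w r = 1%N.
  have [m] := ubnP (d w); elim: m w => // m IHm w.
  have [->|wr] := eqVneq w r; first by rewrite ar eqxx.
  by rewrite (dS w wr) ltnS => /IHm IH; rewrite aS // IH (negPf wr).
exists (fun v => \sum_w f w *+ a w v); split=> [v|]; last first.
  by apply: eq_bigr => w _; rewrite a1.
under eq_bigr => w _ do rewrite aE mulrnDr.
rewrite big_split /= exchange_big /=; congr (_ + _).
  rewrite (bigD1 v) //= eqxx big1 ?addr0 // => w /negPf->; exact: mulr0n.
by apply: eq_bigr => w _; rewrite -sumrMnr.
Qed.

Section TestVector.
Variables (R : realType) (alpha : R) (W : 'I_n -> R).
Hypothesis alpha_lt1 : alpha < 1.
Hypothesis W_gt : forall v, v != r -> alpha < W v.

Let kappa v := if v == r then 1 else (W v - alpha) / (1 - alpha).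

(** Unrolls the prescribed ratios to the parent along the path to the root, with [x_r = 1]. *)
Definition tree_vec (v : 'I_n) : R := \prod_(j < d v) kappa (iter j p v).

Lemma tree_vecS v : v != r ->
  tree_vec v = (W v - alpha) / (1 - alpha) * tree_vec (p v).
Proof.
move=> vr; have [_ dS _] := Gr; rewrite /tree_vec (dS v vr) big_ord_recl /=.
by rewrite {1}/kappa (negPf vr); congr (_ * _); apply: eq_bigr => j _; rewrite -iterSr.
Qed.

Lemma tree_vec_gt0 v : 0 < tree_vec v.
Proof.
apply: prodr_gt0 => j _; rewrite /kappa; case: ifPn => // /W_gt lt.
by rewrite divr_gt0 ?subr_gt0.
Qed.

(** Relative to [x_v], the edge to a child [c] contributes [alpha + (W c - alpha) = W c], and the
    edge to the parent contributes [alpha + (1 - alpha)^2 / (W v - alpha)]. *)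
Lemma tree_opE v : alpha_op alpha G tree_vec v = tree_vec v *
  ((if v == r then 0 else alpha + (1 - alpha) ^+ 2 / (W v - alpha))
   + \sum_(c | child v c) W c).
Proof.
have b0 : 1 - alpha != 0 by rewrite subr_eq0 eq_sym lt_eqF.
have chE : \sum_(c | child v c) tree_vec c =
    (\sum_(c | child v c) W c - #|child v|%:R * alpha) / (1 - alpha) * tree_vec v.
  rewrite mulr_natl -sumr_const -sumrB !mulr_suml.
  by apply: eq_bigr => c /andP[cr /eqP <-]; rewrite tree_vecS.
rewrite /alpha_op rooting_sum chE rooting_degree natrD.
case: (eqVneq v r) => [->|vr] /=; first by field.
have W0 : W v - alpha != 0 by rewrite subr_eq0 gt_eqF // W_gt.
by rewrite (tree_vecS vr); field; rewrite b0 W0.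
Qed.
End TestVector.
End Rooting.

(** * Edge constants of S* *)

Section Constants.
Variables (R : realType) (alpha z : R).

(* [Lw] and [Lw + Dw] are [alpha + (1 - alpha) x_v / x_c] for the Perron vector
   [x] of S*_{n,i}, its centre [c], and [v] a pendant, resp. non-pendant,
   neighbour of [c]; here [z] stands for [lambda - alpha]. *)
Definition Lw : R := alpha + (1 - alpha) ^+ 2 / z.
Definition Dw : R := (1 - alpha) ^+ 2 / (z - Lw) - (1 - alpha) ^+ 2 / z.

Hypothesis alpha_ge0 : 0 <= alpha.
Hypothesis alpha_lt1 : alpha < 1.
Hypothesis z_gt0 : 0 < z.
Hypothesis z_ge : z + (1 - alpha) ^+ 2 <= z ^+ 2.

Let b := 1 - alpha.
Let b_gt0 : 0 < b. Proof. by rewrite subr_gt0. Qed.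
Let bb_gt0 : 0 < b ^+ 2. Proof. by rewrite exprn_gt0. Qed.

(** Multiplied by [z], this is exactly [z_ge]. *)
Lemma z_sub_Lw_ge : 1 - alpha <= z - Lw.
Proof.
rewrite -(ler_pM2l z_gt0) /Lw.
have -> : z * (z - (alpha + (1 - alpha) ^+ 2 / z)) =
  z ^+ 2 - alpha * z - (1 - alpha) ^+ 2 by field; rewrite gt_eqF.
by move: z_ge; lra.
Qed.

Lemma z_sub_Lw_gt0 : 0 < z - Lw.
Proof. by apply: lt_le_trans z_sub_Lw_ge; rewrite subr_gt0. Qed.

Lemma Lw_gt : alpha < Lw.
Proof. by rewrite ltrDl divr_gt0. Qed.

Lemma Lw_gt0 : 0 < Lw.
Proof. exact: le_lt_trans Lw_gt. Qed.

Lemma DwE : Dw = (1 - alpha) ^+ 2 * Lw / (z * (z - Lw)).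
Proof. by rewrite /Dw; field; rewrite !gt_eqF ?z_sub_Lw_gt0. Qed.

Lemma Dw_gt0 : 0 < Dw.
Proof. by rewrite DwE !(divr_gt0, mulr_gt0) ?Lw_gt0 ?z_sub_Lw_gt0. Qed.

(** By [DwE] this amounts to [(1 - alpha)^2 < z (z - Lw)], and [z > 1 - alpha] while
    [z - Lw >= 1 - alpha]. *)
Lemma Dw_lt : Dw < Lw.
Proof.
have zu : 0 < z * (z - Lw) by rewrite mulr_gt0 ?z_sub_Lw_gt0.
rewrite DwE ltr_pdivrMr // mulrC ltr_pM2l ?Lw_gt0 //.
have bz : b < z by have := z_sub_Lw_ge; have := Lw_gt0; rewrite /b; lra.
have := ler_wpM2l (ltW z_gt0) z_sub_Lw_ge; apply: lt_le_trans.
by rewrite expr2 -/b ltr_pM2r.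
Qed.

Lemma leaf_identity : (1 - alpha) ^+ 2 / (Lw - alpha) = z.
Proof.
have -> : Lw - alpha = (1 - alpha) ^+ 2 / z by rewrite /Lw; ring.
by rewrite invf_div mulrC divfK // gt_eqF.
Qed.

(** [Dw] is chosen so that [(z - t) (t + Dw - alpha)] equals [(1 - alpha)^2] at [t = Lw]; the slack,
    cleared of its denominator, is thus a quadratic in [t] with root [Lw]. *)
Lemma branch_identity t : alpha < t + Dw ->
  z - (t + (1 - alpha) ^+ 2 / (t + Dw - alpha)) =
  (t - Lw) * (z + alpha - Lw - Dw - t) / (t + Dw - alpha).
Proof.
rewrite -subr_gt0 => y0; have u0 := z_sub_Lw_gt0.
have e : (z - Lw) * (Lw + Dw - alpha) = (1 - alpha) ^+ 2.
  have -> : Lw + Dw - alpha = (1 - alpha) ^+ 2 / (z - Lw) by rewrite /Dw /Lw; ring.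
  by rewrite mulrC divfK // gt_eqF.
have y0' : t + Dw - alpha != 0 by rewrite gt_eqF.
apply: (mulIf y0'); rewrite divfK // mulrBl mulrDl divfK // -e.
by move: Lw Dw => l e'; ring.
Qed.

End Constants.

(** In S*_{n,i}, [k = n - i - 1] neighbours of the centre carry a pendant edge and [s = i - k] are
    pendant. The equation for [z] is solved by the intermediate value theorem. *)
Lemma Sstar_radius_exists (R : realType) (alpha : R) (s k : nat) :
  0 <= alpha -> alpha < 1 -> (0 < s)%N -> (0 < k)%N || (2 < s)%N ->
  exists z, [/\ 0 < z, z + (1 - alpha) ^+ 2 <= z ^+ 2 &
    z + alpha = Lw alpha z *+ (s + k) + Dw alpha z *+ k].
Proof.
move=> a0 a1 s0 ks; set b := 1 - alpha.
have b0 : 0 < b by rewrite subr_gt0.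
have b1 : b <= 1 by rewrite /b; lra.
have bb0 : 0 < b ^+ 2 by rewrite exprn_gt0.
have bb1 : b ^+ 2 <= 1 by rewrite expr_le1 // ltW.
(* The positive root of [z^2 = z + b^2], the least positive [z] allowed by the second condition. *)
pose z0 : R := (1 + Num.sqrt (1 + 4 * b ^+ 2)) / 2.
have D0 : 0 <= 1 + 4 * b ^+ 2 by lra.
have S2 := sqr_sqrtr D0; have S0 := sqrtr_ge0 (1 + 4 * b ^+ 2).
have z0E : z0 ^+ 2 = z0 + b ^+ 2.
  rewrite /z0; move: (Num.sqrt _) S2 => S S2.
  have -> : ((1 + S) / 2) ^+ 2 = (1 + 2 * S + S ^+ 2) / 4 by field.
  by rewrite S2; field.
have z0_gt : 1 / 2 <= z0 by rewrite /z0; lra.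
have z0_ge1 : 1 <= z0 by nra.
have z0b : b + 1 / 2 <= z0 by nra.
have z0_le : z0 <= 2 by nra.
pose N : R := (s + k)%:R.
have N2 : 2 <= N by rewrite /N (ler_nat R 2); lia.
(* The equation cleared of denominators: for [z >= z0], [q.[z]] is a positive multiple of left side
   minus right side. *)
pose q : {poly R} := (('X + (alpha - N * alpha)%:P) * 'X - (N * b ^+ 2)%:P)
   * ('X^2 - alpha *: 'X - (b ^+ 2)%:P)
   - (k%:R * b ^+ 2) *: (alpha *: 'X + (b ^+ 2)%:P).
have qE z : z0 <= z -> [/\ 0 < z, z + b ^+ 2 <= z ^+ 2,
    0 < z * (z - Lw alpha z) &
    q.[z] = z * (z * (z - Lw alpha z)) *
      (z + alpha - (Lw alpha z *+ (s + k) + Dw alpha z *+ k))].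
  move=> zz; have z_gt0 : 0 < z by lra.
  have z_ge : z + b ^+ 2 <= z ^+ 2 by nra.
  have u0 := z_sub_Lw_gt0 a1 z_gt0 z_ge.
  have zu0 : 0 < z * (z - Lw alpha z) by rewrite mulr_gt0.
  split => //; rewrite -[Lw _ _ *+ _]mulr_natr -[Dw _ _ *+ _]mulr_natr
    DwE // !hornerE /= -/N.
  have bE : b ^+ 2 = (Lw alpha z - alpha) * z.
    have -> : Lw alpha z - alpha = b ^+ 2 / z by rewrite /Lw -/b; ring.
    by rewrite divfK // gt_eqF.
  rewrite -[N * b * b]mulrA -[k%:R * b * b]mulrA -/b -expr2 bE.
  move: (Lw alpha z) u0 => L u0.
  by field; rewrite !gt_eqF.
have [z0p z0g z0u q0] := qE z0 (lexx _).
have L0 : Lw alpha z0 = z0 - b.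
  apply: (mulfI (lt0r_neq0 z0p)); rewrite /Lw mulrDr [_ * (_ / _)]mulrC divfK ?gt_eqF //.
  by rewrite -/b mulrBr -expr2 z0E /b; ring.
have D0E : Dw alpha z0 = 1 - (z0 - b).
  have zbE : z0 - (z0 - b) = b by ring.
  rewrite DwE // L0 zbE -/b; apply: (mulIf (lt0r_neq0 z0p)).
  have zn := lt0r_neq0 z0p; have bn := lt0r_neq0 b0.
  transitivity (b * (z0 - b)); first by field; rewrite zn bn.
  have -> : (1 - (z0 - b)) * z0 = z0 - z0 ^+ 2 + b * z0 by ring.
  by rewrite z0E; ring.
(* At [z0], [Lw + Dw = 1]. With [w = Lw] the claim is [1 + w <= s w + k], which follows from
   [s, k >= 1], or from [s >= 3] and [w >= 1/2]. *)
have q0le : q.[z0] <= 0.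
  rewrite q0 mulr_ge0_le0 //; first by rewrite ltW // mulr_gt0.
  rewrite -[Lw _ _ *+ _]mulr_natr -[Dw _ _ *+ _]mulr_natr
    L0 D0E natrD.
  have sR : 1 <= s%:R :> R by rewrite (ler_nat R 1).
  have k0R : 0 <= k%:R :> R by rewrite ler0n.
  have : 1 <= k%:R :> R \/ 3 <= s%:R :> R.
    by case/orP: ks => ?; [left; rewrite (ler_nat R 1) | right; rewrite (ler_nat R 3)].
  have -> : z0 + alpha = 1 + (z0 - b) by rewrite /b; ring.
  have : 1 / 2 <= z0 - b by lra.
  move: (z0 - b) => w w_ge [k1|s3]; have w0 : 0 <= w by lra.
    have : 0 <= w * (s%:R - 1) by rewrite mulr_ge0 // subr_ge0.
    by lra.
  have : 0 <= w * (s%:R - 3) by rewrite mulr_ge0 // subr_ge0.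
  by lra.
have zN : z0 <= N by lra.
have [zNp zNg zNu qN] := qE N zN.
have qN0 : 0 <= q.[N].
  rewrite qN mulr_ge0 //; first by rewrite ltW // mulr_gt0.
  (* This gives [s Lw + k (Lw + Dw) <= s + k = N]. *)
  have LD : Lw alpha N + Dw alpha N <= 1.
    have -> : Lw alpha N + Dw alpha N = alpha + b ^+ 2 / (N - Lw alpha N).
      by rewrite /Dw /Lw -/b; ring.
    rewrite -lerBrDl ler_pdivrMr ?z_sub_Lw_gt0 // -/b expr2 ler_pM2l //.
    exact: z_sub_Lw_ge.
  have D0' := Dw_gt0 a0 a1 zNp zNg.
  have sR : 0 <= s%:R :> R by rewrite ler0n.
  have k0R : 0 <= k%:R :> R by rewrite ler0n.
  rewrite -[Lw _ _ *+ _]mulr_natr -[Dw _ _ *+ _]mulr_natr.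
  move: (Lw _ _) (Dw _ _) LD D0' => l e LD e0; rewrite /N natrD.
  have l1 : 0 <= 1 - l by lra.
  have le1 : 0 <= 1 - (l + e) by lra.
  by have := mulr_ge0 sR l1; have := mulr_ge0 k0R le1; lra.
have [z /andP[z0z _] /rootP qz] := poly_ivt zN (introT andP (conj q0le qN0)).
have [zp zg zu qzE] := qE z z0z.
exists z; split=> //; apply/eqP; rewrite -subr_eq0.
move: qz; rewrite qzE => /eqP; rewrite mulf_eq0 => /orP[|//].
by rewrite gt_eqF // mulr_gt0.
Qed.

(** * Rooting a tree by distance *)

Section BreadthFirst.
Variables (n : nat) (G : sgraph n) (r : 'I_n).
Hypothesis Gc : is_connected G.

Lemma distance_exists : exists d : 'I_n -> nat,
  [/\ d r = 0%N, forall v, v != r -> exists2 u, G v u & d v = (d u).+1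
    & forall u v, G u v -> (d v <= (d u).+1)%N].
Proof.
pose P v k := [exists t : k.-tuple 'I_n, path G r t && (last r t == v)].
have PE v : exists k, P v k.
  have /connectP[t Gt ->] := Gc r v.
  by exists (size t); apply/existsP; exists (in_tuple t); rewrite Gt eqxx.
pose d v := ex_minn (PE v).
have dP v t : path G r t -> last r t = v -> (d v <= size t)%N.
  move=> Gt tv; rewrite /d; case: ex_minnP => k _; apply.
  by apply/existsP; exists (in_tuple t); rewrite Gt tv eqxx.
have dE v : exists t, [/\ path G r t, last r t = v & size t = d v].
  rewrite /d; case: ex_minnP => k /existsP[t /andP[Gt /eqP tv]] _.
  by exists t; rewrite size_tuple.
have dS u v : G u v -> (d v <= (d u).+1)%N.
  have [t [Gt tu <-]] := dE u => Guv; rewrite -(size_rcons t v).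
  by apply: dP; rewrite ?last_rcons // rcons_path Gt tu.
exists d; split=> // [|v vr]; first by apply/eqP; rewrite -leqn0; exact: (dP r [::]).
have [t [Gt tv ts]] := dE v.
case/lastP: t Gt tv ts => [|t w]; first by move=> _ /= e; rewrite e eqxx in vr.
rewrite rcons_path last_rcons size_rcons => /andP[Gt Gw] wv ts.
rewrite wv in Gw; exists (last r t); first by rewrite adj_sym.
apply/eqP; rewrite eqn_leq dS // -ts ltnS.
exact: dP.
Qed.
End BreadthFirst.

(* Two neighbours of [v] joined by a path avoiding [v] lie on a cycle. *)
Lemma acyclic_unique_neighbor n (G : sgraph n) (S : {set 'I_n}) v a b :
  acyclic G -> v \notin S ->
  connect (fun x y => [&& G x y, x \in S & y \in S]) a b ->
  a \in S -> G v a -> G v b -> a = b.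
Proof.
move=> Gac vS /connectP[t0 t0P ->] aS Gva; case/shortenP: t0P => t tP tu _ Gvb.
case: t => [//|w t] in tP tu Gvb *; case: (Gac [:: v, a, w & t]) => //.
have [tG tS] : path G a (w :: t) /\ all (mem S) (w :: t).
  elim: (w :: t) a tP {tu Gvb aS Gva} => [//|y s IHs] x /= /andP[/and3P[-> _ ->]].
  exact: IHs.
have cG : path G a (rcons (w :: t) v) by rewrite rcons_path tG adj_sym.
apply/andP; split; first by apply/andP; split; [exact: Gva | exact: cG].
rewrite cons_uniq tu andbT inE negb_or; apply/andP; split; first by apply: contraNneq vS => ->.
by apply: contra vS => /(allP tS).
Qed.

Lemma tree_rooting n (G : sgraph n) (r : 'I_n) : is_tree G ->
  exists p d, rooting G r p d.
Proof.
case=> Gc Gac; have [d [dr dp dS]] := distance_exists r Gc.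
pose p v := odflt r [pick u | G v u && (d v == (d u).+1)].
have pP v : v != r -> G v (p v) /\ d v = (d (p v)).+1.
  move=> /dp[u Gvu dvu]; rewrite /p; case: pickP => [w /andP[? /eqP]|/(_ u)] //.
  by rewrite Gvu dvu eqxx.
have dr0 v : d v = 0%N -> v = r.
  by move=> dv; apply/eqP; apply: contraT => /pP[_]; rewrite dv.
pose e (S : {set 'I_n}) := (fun x y => [&& G x y, x \in S & y \in S]).
have eC S : connect_sym (e S).
  by apply: sym_connect_sym => x y; rewrite /e adj_sym; case: (G y x); rewrite //= andbC.
(* Passing to parents lowers the depth, so the path to [r] stays in any set containing all depths up
   to [k]. *)
have Sr (S : {set 'I_n}) k v : (forall w, d w <= k -> w \in S)%N -> (d v <= k)%N ->
    connect (e S) v r.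
  move=> SP; have [m] := ubnP (d v); elim: m v => // m IHm v dm dk.
  have [->|vr] := eqVneq v r; first exact: connect0.
  have [Gv dv] := pP v vr; rewrite dv ltnS in dm.
  apply: connect_trans (IHm _ dm _); last by rewrite ltnW // -dv.
  by apply: connect1; rewrite /e Gv !SP // ltnW // -dv.
(* [v] and [p u] are joined through vertices shallower than [u], so by acyclicity they coincide. *)
have down u v : G u v -> (d v < d u)%N -> p u = v.
  move=> Guv dvu; have ur : u != r by apply: contraTneq dvu => ->; rewrite dr.
  have [Gu du] := pP u ur.
  pose S := [set w | (d w < d u)%N].
  have SP w : (d w <= d (p u))%N -> w \in S by rewrite inE du.
  apply: (acyclic_unique_neighbor Gac (S := S) (v := u)) => //.
  - by rewrite inE ltnn.
  - apply: connect_trans (Sr S _ _ SP _) _ => //.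
    by rewrite eC; apply: Sr SP _; rewrite -ltnS -du.
  - by rewrite inE du.
exists p, d; split=> // [v /pP[]//|u v].
apply/idP/orP => [Guv|[/andP[ur /eqP<-]|/andP[vr /eqP<-]]]; last 2 first.
- by have [] := pP u ur.
- by rewrite adj_sym; have [] := pP v vr.
have nr x y : (d x < d y)%N -> y != r by apply: contraTneq => ->; rewrite dr.
case: (ltngtP (d u) (d v)) => [lt|lt|duv].
- by right; rewrite (nr u v lt) (down v u) ?eqxx // adj_sym.
- by left; rewrite (nr v u lt) (down u v) ?eqxx.
have uv : u != v by apply: contraTneq Guv => ->; rewrite adj_irrefl.
have ur : u != r.
  by apply: contraNneq uv => ur; rewrite ur eq_sym (dr0 v) // -duv ur dr.
have vr : v != r by apply: contraNneq ur => vr; rewrite (dr0 u) // duv vr dr.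
(* Otherwise [v] and [p u], which are joined outside [u], would both be
   neighbours of [u]. *)
pose S := [set w | (d w <= d (p u))%N] :|: [set v].
have [Gu du] := pP u ur; have [Gv dv] := pP v vr.
have SP w : (d w <= d (p u))%N -> w \in S by rewrite !inE => ->.
have dpv : (d (p v) <= d (p u))%N by rewrite -ltnS -dv -duv du.
have vS : v \in S by rewrite !inE eqxx orbT.
suff vpu : v = p u by move: duv; rewrite vpu du => /esym/n_Sn.
apply: (acyclic_unique_neighbor Gac (S := S) (v := u)) => //.
  by rewrite !inE du ltnn (negPf uv).
apply: (@connect_trans _ _ (p v)).
  by apply: connect1; rewrite /e Gv vS SP.
apply: connect_trans (Sr S _ _ SP dpv) _.
by rewrite eC; apply: Sr SP _.
Qed.

(** * Trees with few leaves *)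

Section Branches.
Variables (n : nat) (G : sgraph n) (r : 'I_n) (p : 'I_n -> 'I_n) (d : 'I_n -> nat).
Hypothesis Gr : rooting G r p d.

Definition inner : pred 'I_n := [pred v | (v != r) && ~~ leaf r p v].

Lemma card_leaf_inner : (#|leaf r p| + #|inner|)%N = n.-1.
Proof.
rewrite -[in RHS](card_ord n) -(cardC1 r) -(cardID (leaf r p) (predC1 r)).
congr (_ + _)%N; apply: eq_card => v; rewrite !inE -topredE /=.
  by rewrite /leaf; case: eqP.
by rewrite andbC.
Qed.

(** One end of each edge is the parent of the other, hence not a leaf. *)
Lemma card_leaf_le : (#|leaf r p| <= independence_number G)%N.
Proof.
apply: independence_number_ge => u v lu lv; have [_ _ ->] := Gr.
by have := leaf_child u lv; have := leaf_child v lu; rewrite /child /= => -> ->.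
Qed.

(** Children are counted by parent: an inner vertex spends one of its edges on its own parent, and a
    leaf has no child. *)
Lemma max_degree_count : (forall v, (degree G v <= degree G r)%N) ->
  (n.-1 <= #|child r p r| + #|inner| * #|child r p r|.-1)%N.
Proof.
move=> degr; have dE := rooting_degree Gr.
rewrite -(sum_children r p) (bigD1 r) //= leq_add2l -sum_nat_const.
rewrite [leqRHS]big_mkcond [leqLHS]big_mkcond; apply: leq_sum => v _.
rewrite -topredE /= /inner /=; case: (eqVneq v r) => //= vr.
have [lv|_] /= := boolP (leaf r p v).
  by rewrite eq_card0 // => c; exact: leaf_child.
by have := degr v; rewrite !dE eqxx vr /=; lia.
Qed.

Variables (R : realType) (L D : R).

Lemma leaf_weight_sum :
  \sum_v (if v == r then 0 else if leaf r p v then L else D) =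
  L *+ #|leaf r p| + D *+ #|inner|.
Proof.
rewrite (bigID (leaf r p)) /= -!sumr_const; congr (_ + _).
  by apply: eq_bigr => v lv; rewrite lv; case/andP: lv => /negPf->.
rewrite [RHS](eq_bigl (fun v => ~~ leaf r p v && (v != r))) => [|v]; last first.
  by rewrite -topredE /= andbC.
rewrite big_mkcondr /=; apply: eq_bigr => v /negPf->.
by case: (v == r).
Qed.

Hypotheses (D_ge0 : 0 <= D) (L_ge0 : 0 <= L).
Variable W : 'I_n -> R.
Hypothesis WE : forall v, W v =
  (if v == r then 0 else if leaf r p v then L else D)
  + \sum_(c | child r p v c) W c.

Lemma branch_leaf v : leaf r p v -> W v = L.
Proof.
move=> lv; rewrite WE lv; case/andP: (lv) => /negPf-> _.
by rewrite big_pred0 ?addr0 // => c; exact: leaf_child.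
Qed.

(** Some leaf lies at or below [v]; the induction runs upwards from the deepest level. *)
Lemma branch_ge v : v != r -> L <= W v.
Proof.
pose M := (\max_v d v)%N.
have [m] := ubnP (M - d v)%N; elim: m v => // m IHm v lt vr.
have [/branch_leaf->//|/(leafPn p vr)[c cv]] := boolP (leaf r p v).
have IH c' : child r p v c' -> L <= W c'.
  move=> c'v; apply: IHm; last by case/andP: c'v.
  by have := child_depth Gr c'v; have : (d c' <= M)%N by [exact: leq_bigmax]; lia.
rewrite WE (negPf vr) (bigD1 c) //=.
have : 0 <= \sum_(c' | child r p v c' && (c' != c)) W c'.
  by apply: sumr_ge0 => c' /andP[/IH + _]; apply: le_trans.
by have := IH c cv; case: ifP => _; have := D_ge0; have := L_ge0; lra.
Qed.

Lemma branch_inner v : inner v -> W v = D + \sum_(c | child r p v c) W c.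
Proof. by case/andP=> /negPf vr /negPf lv; rewrite WE vr lv. Qed.

Lemma inner_sum_ge v : inner v -> L <= \sum_(c | child r p v c) W c.
Proof.
case/andP=> vr /(leafPn p vr)[c cv]; rewrite (bigD1 c) //=.
have : 0 <= \sum_(c' | child r p v c' && (c' != c)) W c'.
  by apply: sumr_ge0 => c' /andP[/andP[/branch_ge + _] _]; apply: le_trans.
by have /branch_ge : c != r by [case/andP: cv]; lra.
Qed.

(** [v] lies in the branch of one child of [r], and each of the other branches weighs at least
    [L]. *)
Lemma branch_le_root v : v != r -> W v + L *+ #|child r p r|.-1 <= W r.
Proof.
move=> vr; have [c cr le] : exists2 c, child r p r c & W v <= W c.
  have [m] := ubnP (d v); elim: m v vr => // m IHm v vr lt.
  have [pv|pv] := eqVneq (p v) r; first by exists v; rewrite // /child /= vr pv eqxx.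
  have [_ dS _] := Gr; rewrite (dS v vr) ltnS in lt.
  have [c cr le] := IHm _ pv lt; exists c => //; apply: le_trans le.
  have cv : child r p (p v) v by rewrite /child /= vr eqxx.
  have pvi : inner (p v) by rewrite /inner /= pv; apply/(leafPn p pv); exists v.
  rewrite (branch_inner pvi) (bigD1 v) //=.
  have : 0 <= \sum_(c' | child r p (p v) c' && (c' != v)) W c'.
    by apply: sumr_ge0 => c' /andP[/andP[/branch_ge + _] _]; apply: le_trans.
  by have := D_ge0; lra.
rewrite [leRHS]WE eqxx add0r (bigD1 c) //= lerD //.
rewrite (_ : #|_|.-1 = #|[predD1 child r p r & c]|); last first.
  by rewrite (cardD1 c (child r p r)) (_ : c \in child r p r).
rewrite -sumr_const [leRHS](eq_bigl [predD1 child r p r & c]) => [|c']; last first.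
  by rewrite /= andbC.
by apply: ler_sum => c' /andP[_ /andP[/branch_ge]].
Qed.
End Branches.

(** * Recognising S*_{n,i} from its rooted structure *)

Section SstarIso.
Variables (n i : nat) (G : sgraph n) (r : 'I_n) (p : 'I_n -> 'I_n) (d : 'I_n -> nat).
Hypothesis Gr : rooting G r p d.
Hypothesis inner_child : forall v c, inner r p v -> child r p v c -> leaf r p c.
Hypothesis inner_uniq : forall v c c', inner r p v ->
  child r p v c -> child r p v c' -> c = c'.
Hypothesis leaf_i : #|leaf r p| = i.

Lemma parent_inner v : v != r -> p v != r -> inner r p (p v).
Proof.
move=> vr pv; rewrite /inner /= pv; apply/(leafPn p pv); exists v.
by rewrite /child /= vr eqxx.
Qed.

Lemma grandparent_root v : v != r -> p v != r -> p (p v) = r.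
Proof.
move=> vr pv; apply/eqP; apply: contraT => ppv.
have pvp : child r p (p (p v)) (p v) by rewrite /child /= pv eqxx.
by case/andP: (parent_inner vr pv) => _; rewrite (inner_child (parent_inner pv ppv) pvp).
Qed.

(** Each inner vertex has one child, so [n - 1] is the number of root children plus that of inner
    vertices, and also the number of leaves plus that of inner vertices. *)
Lemma card_root_children : #|child r p r| = i.
Proof.
apply/(@addIn #|inner r p|); rewrite -leaf_i card_leaf_inner -(sum_children r p).
rewrite (bigD1 r) //=; congr addn; rewrite -sum1_card.
rewrite big_mkcond [RHS]big_mkcond; apply: eq_bigr => v _.
rewrite -topredE /= /inner /=; case: (eqVneq v r) => //= vr.
have [lv|/(leafPn p vr)[c cv]] := boolP (leaf r p v).
  by rewrite eq_card0 // => c; exact: leaf_child.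
have vi : inner r p v by rewrite /inner /= vr; apply/(leafPn p vr); exists c.
rewrite /= (eq_card1 (x := c)) // => c'; rewrite inE; apply/idP/eqP => [c'v|->//].
exact: inner_uniq vi c'v cv.
Qed.

Lemma rooting_Sstar_iso : (i < n)%N -> isomorphic G (Sstar n i).
Proof.
move=> i_lt.
(* Children of [r] that have a child come first, since [Sstar] hangs its pendant vertices on the
   leaves of smallest index. *)
pose s1 := enum [predI child r p r & inner r p].
pose s := s1 ++ enum [predD child r p r & inner r p].
have s_mem v : (v \in s) = child r p r v.
  rewrite mem_cat !mem_enum !inE /child /=.
  by case: (v != r); case: (p v == r); case: (leaf r p v).
have s_size : size s = i.
  by rewrite size_cat -!cardE cardID card_root_children.
have s1_size : (size s1 <= #|inner r p|)%N.
  by rewrite -cardE; apply/subset_leq_card/fintype.subsetP=> v; rewrite inE => /andP[].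
have s_inner v : child r p r v -> inner r p v -> (index v s < size s1)%N.
  move=> cv iv; have v1 : v \in s1 by rewrite mem_enum inE; apply/andP; split.
  by rewrite index_cat v1 index_mem.
have s_lt v : child r p r v -> (index v s < i)%N by rewrite -s_mem -s_size index_mem.
have cardE := card_leaf_inner r p.
pose g v := if v == r then 0%N else (index v s).+1.
pose fn v := if (v == r) || (p v == r) then g v else (i + g (p v))%N.
have child_r v : v != r -> p v = r -> child r p r v.
  by move=> vr pv; rewrite /child /= vr pv eqxx.
have g_lt v : v != r -> p v = r -> (0 < g v <= i)%N.
  by move=> vr pv; rewrite /g (negPf vr) /= s_lt // child_r.
have g_inj u v : u != r -> p u = r -> v != r -> p v = r -> g u = g v -> u = v.
  move=> ur pu vr pv; rewrite /g (negPf ur) (negPf vr) => -[].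
  by move/(index_inj u); apply; rewrite s_mem child_r.
(* The three layers of the tree go to 0, to 1..i and beyond i. *)
have layers v : [\/ v = r /\ fn v = 0%N,
    [/\ v != r, p v = r & fn v = g v] |
    [/\ v != r, p v != r, p (p v) = r & fn v = (i + g (p v))%N]].
  rewrite /fn /g; have [->|vr] := eqVneq v r; first by constructor 1.
  have [pv|pv] := eqVneq (p v) r; first by constructor 2.
  by constructor 3; rewrite grandparent_root.
have fP v : (fn v < n)%N.
  case: (layers v) => [[-> ->]|[vr pv ->]|[vr pv ppv ->]]; first exact: leq_ltn_trans i_lt.
    by case/andP: (g_lt v vr pv) => _ /leq_ltn_trans; apply.
  have := s_inner _ (child_r _ pv ppv) (parent_inner vr pv).
  rewrite /g (negPf pv); lia.
have arcE u v : Sstar_arc i (Ordinal (fP u)) (Ordinal (fP v)) = (v != r) && (p v == u).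
  rewrite /Sstar_arc /=.
  case: (layers v) => [[vr fv]|[vr pv fv]|[vr pv ppv fv]].
  - by rewrite fv vr eqxx /=; lia.
  - have := g_lt v vr pv; rewrite fv vr pv /= [r == u]eq_sym.
    case: (layers u) => [[ur ->]|[ur pu ->]|[ur pu ppu ->]].
    + by rewrite ur eqxx; lia.
    + by have := g_lt u ur pu; rewrite (negPf ur); lia.
    + by have := g_lt _ pu ppu; rewrite (negPf ur); lia.
  have := g_lt _ pv ppv; rewrite fv vr /=.
  case: (layers u) => [[ur ->]|[ur pu ->]|[ur pu ppu ->]].
  - by rewrite ur (negPf pv); lia.
  - have := g_lt u ur pu.
    rewrite eqn_add2l (_ : (g (p v) == g u) = (p v == u)); first by lia.
    by apply/eqP/eqP=> [|->//]; exact: g_inj.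
  have := g_lt _ pu ppu.
  have /negPf-> : p v != u by apply: contraNneq pu => <-; rewrite ppv.
  by lia.
exists (fun v => Ordinal (fP v)) => [|u v]; last first.
  by rewrite /= /Sstar_adj !arcE; have [_ _ ->] := Gr; rewrite orbC.
apply: inj_card_bij => // u v [].
case: (layers u) => [[ur ->]|[ur pu ->]|[ur pu ppu ->]];
  case: (layers v) => [[vr ->]|[vr pv ->]|[vr pv ppv ->]].
- by rewrite ur vr.
- by have := g_lt v vr pv; lia.
- by have := g_lt _ pv ppv; lia.
- by have := g_lt u ur pu; lia.
- exact: g_inj.
- by have := g_lt u ur pu; have := g_lt _ pv ppv; lia.
- by have := g_lt _ pu ppu; lia.
- by have := g_lt _ pu ppu; have := g_lt v vr pv; lia.
move/addnI => /(g_inj _ _ pu ppu pv ppv) puv.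
apply: (inner_uniq (parent_inner ur pu)); first by rewrite /child /= ur eqxx.
by rewrite /child /= vr puv eqxx.
Qed.
End SstarIso.

(** * The largest eigenvalue of S*_{n,i} *)

Section SstarRadius.
Variables (n i : nat).
Hypotheses (n_le : (n <= i.*2)%N) (i_lt : (i < n)%N).

Let n_gt0 : (0 < n)%N. Proof. exact: leq_ltn_trans i_lt. Qed.
Let o := Ordinal n_gt0.

Fact Sstar_parent_subproof (v : 'I_n) : ((if v <= i then 0 else v - i) < n)%N.
Proof. by have := ltn_ord v; case: ifP; lia. Qed.

Definition Sstar_parent (v : 'I_n) : 'I_n := Ordinal (Sstar_parent_subproof v).

Definition Sstar_depth (v : 'I_n) : nat := ((0 < v) + (i < v))%N.

Lemma Sstar_child (u v : 'I_n) : child o Sstar_parent u v = Sstar_arc i u v.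
Proof.
rewrite /child /Sstar_arc /= -!val_eqE /=.
by have := ltn_ord u; have := ltn_ord v; case: ifP; lia.
Qed.

Lemma Sstar_rooting : rooting (Sstar n i) o Sstar_parent Sstar_depth.
Proof.
split=> [//|v|u v]; last first.
  by rewrite /= /Sstar_adj -!Sstar_child /child /= orbC.
rewrite /Sstar_depth -val_eqE /=.
by have := ltn_ord v; case: ifP; lia.
Qed.

Variables (R : realType) (alpha z : R).
Hypotheses (alpha_ge0 : 0 <= alpha) (alpha_lt1 : alpha < 1) (z_gt0 : 0 < z).
Hypothesis z_ge : z + (1 - alpha) ^+ 2 <= z ^+ 2.
Hypothesis zE : z + alpha = Lw alpha z *+ i + Dw alpha z *+ (n - i).-1.

Lemma Sstar_lambda : lambda alpha (Sstar n i) = z + alpha.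
Proof.
move: zE; set L := Lw alpha z; set D := Dw alpha z; set k := (n - i).-1 => muE.
have D_gt0 : 0 < D by exact: Dw_gt0.
have L_gt : alpha < L by exact: Lw_gt.
(* Subtree weights: neighbours [1..k] of the centre carry one further vertex and weigh [L + D]; the
   pendant vertices, all of index above [k], weigh [L]. *)
pose W (v : 'I_n) := L + (if (v <= k)%N then D else 0).
have W_gt v : v != o -> alpha < W v.
  by move=> _; rewrite /W; case: ifP => _; lra.
apply: (lambda_positive_eigenvector alpha_lt1 n_gt0 _
          (tree_vec_gt0 (r := o) Sstar_parent Sstar_depth alpha_lt1 W_gt)).
  by rewrite addr_ge0 // ltW.
move=> v; rewrite (tree_opE Sstar_rooting alpha_lt1 W_gt) mulrC; congr (_ * _).
under eq_bigl => c do rewrite Sstar_child.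
have cardP m : (m < n)%N -> #|[pred c : 'I_n | (0 < c <= m)%N]| = m.
  move=> mn; have := card_ord_lt mn; rewrite (cardD1 o) inE /= add1n => -[mE].
  rewrite -[RHS]mE.
  by apply: eq_card => c; rewrite !inE -val_eqE /= lt0n.
have [vo|vo] := eqVneq v o.
  rewrite /= add0r muE (eq_bigl [pred c : 'I_n | (0 < c <= i)%N]) => [|c]; last first.
    by rewrite vo /Sstar_arc /= orbF.
  rewrite big_split /= sumr_const cardP // -big_mkcondr /=.
  rewrite (eq_bigl [pred c : 'I_n | (0 < c <= k)%N]) => [|c]; last by rewrite /= /k; lia.
  by rewrite sumr_const cardP // /k; lia.
have v0 : (0 < v)%N by rewrite lt0n.
rewrite /W; case: ifPn => vk.
  have ivn : (i + v < n)%N by move: vk; rewrite /k; lia.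
  rewrite (big_pred1 (Ordinal ivn)) => [|c]; last first.
    by rewrite /Sstar_arc /= -val_eqE /= gtn_eqF // v0 /=; move: vk; rewrite /k; lia.
  rewrite /= [(i + v <= k)%N](_ : _ = false); last by rewrite /k; lia.
  rewrite addr0; have a_lt : alpha < L + D by lra.
  have := branch_identity alpha_lt1 z_gt0 z_ge a_lt.
  by rewrite -/L -/D subrr !mul0r; lra.
rewrite big_pred0 => [|c]; last first.
  have := ltn_ord c.
  by rewrite /Sstar_arc gtn_eqF //=; move: vk; rewrite /k; lia.
by rewrite !addr0 leaf_identity // addrC.
Qed.
End SstarRadius.

(** * The bound for trees *)

Lemma tree_counts n i l m Delta : (4 <= n)%N -> (uphalf n <= i)%N -> (i < n)%N ->
  (l + m)%N = n.-1 -> (l <= i)%N -> (n.-1 <= Delta + m * Delta.-1)%N ->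
  [/\ (1 < Delta)%N, ((n - i).-1 + i)%N = (l + m)%N &
      l = i -> (Delta <= 2)%N -> i = 2 /\ (n - i).-1 = 1%N].
Proof.
move=> n4 ni i_lt lE l_le; case: Delta => [|[|Delta]] /=; try lia.
move=> Delta_le; split=> [//||li D0]; first by lia.
(* The root then has two children, so [n - 1 <= 2 + m], that is [i = l <= 2]; with [4 <= n <= 2 i]
   this leaves [n = 4]. *)
have D00 : Delta = 0%N by lia.
by rewrite D00 muln1 in Delta_le; lia.
Qed.

Lemma tree_bound (R : realType) n i (G : sgraph n) (alpha : R) :
  (4 <= n)%N -> is_tree G ->
  independence_number G = i -> (uphalf n <= i < n)%N ->
  0 <= alpha < 1 ->
  lambda alpha G <= lambda alpha (Sstar n i)
  /\ (lambda alpha G = lambda alpha (Sstar n i)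
      <-> isomorphic G (Sstar n i)).
Proof.
move=> n4 Gt iE /andP[ni i_lt] /andP[a0 a1].
have n_le : (n <= i.*2)%N by lia.
(* Here [s = i - (n - i - 1)]; for a star, [i = n - 1], the condition [2 < s] is [4 <= n]. *)
have [z [z_gt0 z_ge zE0]] : exists z, [/\ 0 < z, z + (1 - alpha) ^+ 2 <= z ^+ 2 &
    z + alpha = Lw alpha z *+ ((i - (n - i).-1) + (n - i).-1) + Dw alpha z *+ (n - i).-1].
  by apply: Sstar_radius_exists => //; lia.
have zE : z + alpha = Lw alpha z *+ i + Dw alpha z *+ (n - i).-1.
  by rewrite [LHS]zE0 subnK //; lia.
rewrite (Sstar_lambda n_le i_lt a0 a1 z_gt0 z_ge zE).
set L := Lw alpha z in zE; set D := Dw alpha z in zE; set mu := z + alpha in zE *.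
have D_gt0 : 0 < D by exact: Dw_gt0.
have L_gt : alpha < L by exact: Lw_gt.
have L_gt0 : 0 < L by exact: le_lt_trans L_gt.
have DL : D < L by exact: Dw_lt.
have mu_gt0 : 0 < mu by rewrite ltr_wpDr.
have n_gt0 : (0 < n)%N by exact: leq_trans n4.
(* Maximal degree gives [r] at least two children, hence a leaf outside every proper branch. *)
have [r degr] : exists r, forall v, (degree G v <= degree G r)%N.
  case: (arg_maxnP (degree G) (erefl : xpredT (Ordinal n_gt0))) => r _ degr.
  by exists r => v; exact: degr.
have [p [d Gr]] := tree_rooting r Gt.
have l_le := card_leaf_le Gr; rewrite iE in l_le.
have lE := card_leaf_inner r p.
set l := #|leaf r p| in l_le lE *; set m := #|inner r p| in lE *.
set Delta := #|child r p r|.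
have [Delta_gt1 kE DeltaE] : [/\ (1 < Delta)%N, ((n - i).-1 + i)%N = (l + m)%N &
    l = i -> (Delta <= 2)%N -> i = 2 /\ (n - i).-1 = 1%N].
  exact: tree_counts n4 ni i_lt lE l_le (max_degree_count Gr degr).
have [W [WE Wr]] := subtree_sums Gr
  (fun v => if v == r then 0 else if leaf r p v then L else D).
rewrite leaf_weight_sum -/l -/m in Wr.
have W_ge := branch_ge Gr (ltW D_gt0) (ltW L_gt0) WE.
have W_root := branch_le_root Gr (ltW D_gt0) (ltW L_gt0) WE; rewrite -/Delta in W_root.
have W_gt v : v != r -> alpha < W v by move/W_ge; apply: lt_le_trans.
have x_gt0 := tree_vec_gt0 p d a1 W_gt.
have opE := tree_opE Gr a1 W_gt.
have rE : \sum_(c | child r p r c) W c = W r by rewrite [RHS]WE eqxx add0r.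
have lR : l%:R <= i%:R :> R by rewrite ler_nat.
(* Both sides distribute [L] and [D] over [n - 1] vertices; [mu] uses [L] for [i] of them, [W r] for
   [l]. *)
have muW : mu - W r = (L - D) * (i%:R - l%:R).
  have mR : (n - i).-1%:R = l%:R + m%:R - i%:R :> R.
    by rewrite -natrD -kE natrD addrK.
  rewrite zE Wr -[L *+ i]mulr_natr -[D *+ _]mulr_natr mR.
  by rewrite -[L *+ l]mulr_natr -[D *+ m]mulr_natr; ring.
have Wr_le : W r <= mu by rewrite -subr_ge0 muW mulr_ge0 // subr_ge0 // ltW.
have slack v : inner r p v ->
    z - (\sum_(c | child r p v c) W c + (1 - alpha) ^+ 2 / (W v - alpha)) =
    (\sum_(c | child r p v c) W c - L) * (mu - L - W v) / (W v - alpha).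
  move=> vi; have Wv := branch_inner WE vi; set t := \sum_(c | _) _ in Wv *.
  have t_gt : alpha < t + D by rewrite addrC -Wv W_gt //; case/andP: vi.
  have := branch_identity a1 z_gt0 z_ge t_gt.
  rewrite -/L -/D [W v]Wv [D + t]addrC => ->; congr (_ * _ / _).
  by rewrite /mu; ring.
have op_le v : alpha_op alpha G (tree_vec r p d alpha W) v
    <= mu * tree_vec r p d alpha W v.
  rewrite opE mulrC ler_pM2r //.
  have [->|vr] := eqVneq v r; first by rewrite /= add0r rE.
  have [lv|nlv] := boolP (leaf r p v).
    rewrite (branch_leaf WE lv) leaf_identity // big_pred0 ?addr0 1?addrC // => c.
    exact: leaf_child.
  have vi : inner r p v by rewrite /inner /= vr.
  have t_ge := inner_sum_ge Gr (ltW D_gt0) (ltW L_gt0) WE vi.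
  have Wv_le : W v <= mu - L.
    have := W_root v vr; have : L <= L *+ Delta.-1.
      by rewrite -[leLHS]mulr1n ler_pMn2l // -ltnS prednK // ltnW.
    by move: Wr_le; lra.
  have : 0 <= (\sum_(c | child r p v c) W c - L) * (mu - L - W v) / (W v - alpha).
    by rewrite divr_ge0 ?mulr_ge0 // ?subr_ge0 // ltW // W_gt.
  by rewrite -slack //= /mu; lra.
split; first by apply: lambda_le op_le _; rewrite // ltW.
split=> [GE|GS]; last first.
  by rewrite (lambda_iso alpha GS) (Sstar_lambda n_le i_lt a0 a1 z_gt0 z_ge zE).
have Gc : is_connected G by case: Gt.
have bE v : (if v == r then 0 else alpha + (1 - alpha) ^+ 2 / (W v - alpha))
    + \sum_(c | child r p v c) W c = mu.
  apply: (mulfI (lt0r_neq0 (x_gt0 v))); rewrite -opE mulrC.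
  exact: (lambda_eq a1 x_gt0 op_le mu_gt0 Gc GE).
have Wr_mu : W r = mu by have := bE r; rewrite eqxx add0r rE.
have li : l = i.
  apply/eqP; rewrite -(eqr_nat R) eq_sym -subr_eq0; apply/eqP.
  have LD0 : L - D != 0 by rewrite subr_eq0 gt_eqF.
  by apply: (mulfI LD0); rewrite -muW Wr_mu subrr mulr0.
(* Equality makes the slack vanish, so either the weight below [v] is [L] or [W v = mu - L]. *)
have t_L v : inner r p v -> \sum_(c | child r p v c) W c = L.
  move=> vi; have vr : v != r by case/andP: vi.
  have W0 : W v - alpha != 0 by rewrite subr_eq0 gt_eqF // W_gt.
  have := bE v; rewrite (negPf vr) /mu => bv.
  have /eqP : (\sum_(c | child r p v c) W c - L) * (mu - L - W v) / (W v - alpha) = 0.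
    by rewrite -slack //; lra.
  rewrite !mulf_eq0 invr_eq0 (negPf W0) orbF subr_eq0 => /orP[/eqP//|/eqP Wv].
  (* Here [r] has only one further neighbour, a pendant one; as [r] has maximal
     degree, [G] is then a path, so [n = 4]. *)
  have [i2 k1] : i = 2 /\ (n - i).-1 = 1%N.
    apply: DeltaE => //; rewrite leqNgt; apply/negP => Delta3.
    have := W_root v vr; have : L *+ 2 <= L *+ Delta.-1.
      by rewrite ler_pMn2l // -ltnS prednK // ltnW.
    by rewrite mulr2n; move: Wr_mu Wv L_gt0; lra.
  (* Now [mu = 2 L + D], so [W v = mu - L] also yields weight [L] below [v]. *)
  have := branch_inner WE vi; move: zE Wv; rewrite k1 i2 mulr2n mulr1n; lra.
(* Weight [L] below [v] means a single leaf: an inner child would weigh [L + D], and two children at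
   least [2 L]. *)
apply: (rooting_Sstar_iso Gr) => // [v c vi cv|v c c' vi cv c'v].
  have cr : c != r by case/andP: cv.
  have := t_L v vi; rewrite (bigD1 c) //=.
  have : 0 <= \sum_(c' | child r p v c' && (c' != c)) W c'.
    by apply: sumr_ge0 => c' /andP[/andP[/W_ge + _] _]; apply: le_trans; apply: ltW.
  have [//|lc] := boolP (leaf r p c); have ci : inner r p c by rewrite /inner /= cr.
  by have := t_L c ci; have := branch_inner WE ci; lra.
apply/eqP; apply: contraT => cc'.
have := t_L v vi; rewrite (bigD1 c) //= (bigD1 c') /=; last by rewrite c'v eq_sym.
have : 0 <= \sum_(w | (child r p v w && (w != c)) && (w != c')) W w.
  by apply: sumr_ge0 => w /andP[/andP[/andP[/W_ge + _] _] _]; apply: le_trans; apply: ltW.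
have : L <= W c by apply: W_ge; case/andP: cv.
have : L <= W c' by apply: W_ge; case/andP: c'v.
by move: L_gt0; lra.
Qed.

Theorem theorem1p5 (R : realType) :
  (forall (n i : nat) (G : sgraph n) (alpha : R),
     is_connected G -> is_bipartite G ->
     independence_number G = i -> (uphalf n <= i < n)%N ->
     1 / 2 <= alpha < 1 ->
     lambda alpha G <= lambda alpha (Kbip i (n - i))
     /\ (lambda alpha G = lambda alpha (Kbip i (n - i))
         <-> isomorphic G (Kbip i (n - i))))
  /\
  (forall (n i : nat) (G : sgraph n) (alpha : R),
     (4 <= n)%N -> is_tree G ->
     independence_number G = i -> (uphalf n <= i < n)%N ->
     0 <= alpha < 1 ->
     lambda alpha G <= lambda alpha (Sstar n i)
     /\ (lambda alpha G = lambda alpha (Sstar n i)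
         <-> isomorphic G (Sstar n i))).
Proof.
split=> n i G alpha; first exact: bipartite_bound.
exact: tree_bound.
Qed.
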